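(* Let $G$ be a compact Hausdorff topological group, let $X$ be a metrizable $G$-space and let $A\subset X$ be a $G$-homotopy dense subset. If $A$ is a $G$-ANR, then $X$ is also a $G$-ANR.
   Context: $G$ is a compact Hausdorff topological group. All spaces are completely regular and Hausdorff, and all maps are continuous. A $G$-space is a space with a continuous action of $G$; a $G$-map is a continuous map $f$ with $f(gx)=gf(x)$ for all $g\in G$ and all $x$. A subset $S$ of a $G$-space is invariant if $gs\in S$ for all $g\in G$, $s\in S$. A metrizable $G$-space is a $G$-space whose underlying space is metrizable. $G$-ANR: a metrizable $G$-space $Y$ is a $G$-ANR if for every closed $G$-embedding $Y\hookrightarrow Z$ in a metrizable $G$-space $Z$ there exist an invariant neighborhood $U$ of $Y$ in $Z$ and a $G$-retraction $r:U\to Y$ (i.e. a $G$-map that is the identity on $Y$). $G$-homotopy: with $I=[0,1]$, a $G$-homotopy is a continuous map $F:X\times I\to Y$ that is a $G$-map for the action $g(x,t)=(gx,t)$ on $X\times I$; write $F_t(x)=F(x,t)$. $G$-homotopy dense: an invariant subset $A$ of a $G$-space $X$ is $G$-homotopy dense in $X$ if there exists a $G$-homotopy $F:X\times I\to X$ with $F_0=\mathrm{id}_X$ and $F_t(X)\subset A$ for every $t\in(0,1]$. *)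

(* Defs.v *)
From HB Require Import structures.
From mathcomp Require Import all_boot all_order all_algebra.
From mathcomp Require Import all_classical all_reals all_analysis.

Set Implicit Arguments.
Unset Strict Implicit.
Unset Printing Implicit Defensive.

Import Order.TTheory GRing.Theory Num.Theory.
Import numFieldNormedType.Exports.
Local Open Scope classical_set_scope.
Local Open Scope ring_scope.

HB.mixin Record isTopologicalGroup G & Topological G & Group G := {
  mulg_continuous : continuous (fun p : G * G => (p.1 * p.2)%g) ;
  invg_continuous : continuous (fun x : G => (x^-1)%g)
}.

#[short(type="topologicalGroupType")]
HB.structure Definition TopologicalGroup :=
  {G of Topological G & Group G & isTopologicalGroup G}.

HB.mixin Record isGSpace (G : topologicalGroupType) X & Topological X := {
  gact : G -> X -> X ;
  gact1 : forall x, gact 1%g x = x ;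
  gactM : forall g h x, gact (g * h)%g x = gact g (gact h x) ;
  gact_continuous : continuous (fun p : G * X => gact p.1 p.2)
}.

#[short(type="gSpaceType")]
HB.structure Definition GSpace (G : topologicalGroupType) :=
  {X of Topological X & isGSpace G X}.

Definition metrizable (R : realType) (T : topologicalType) : Prop :=
  exists d : T -> T -> R,
    [/\ forall x, d x x = 0,
        forall x y, d x y = 0 -> x = y,
        forall x y, d x y = d y x,
        forall y x z, d x z <= d x y + d y z
      & forall x (B : set T),
          nbhs x B <-> exists2 e, 0 < e & [set y | d x y < e] `<=` B].

Lemma metric_metrizable (R : realType) (T : metricType R) : metrizable R T.
Proof.
exists (@mdist R T); split.
- exact: mdistxx.
- exact: mdist_positivity.
- exact: metric_sym.
- by move=> y x z; exact: metric_triangle.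
- move=> x B; rewrite -nbhs_ballE; split.
  + by case=> e /= e0 eB; exists e => // y; rewrite -ballEmdist; exact: eB.
  + by case=> e e0 eB; exists e => //= y; rewrite ballEmdist; exact: eB.
Qed.

Section GSpaces.
Context {G : topologicalGroupType}.

Definition gmap (X Y : gSpaceType G) (f : X -> Y) : Prop :=
  continuous f /\ forall (g : G) x, f (gact g x) = gact g (f x).

Definition invariant_set (X : gSpaceType G) (S : set X) : Prop :=
  forall (g : G) s, S s -> S (gact g s).

(* Injective, continuous, and open onto its image: a homeomorphism onto
   [range f] with the subspace topology *)
Definition embedding (X Y : topologicalType) (f : X -> Y) : Prop :=
  [/\ continuous f, injective f
    & forall U, open U -> exists2 V, open V & f @` U = range f `&` V].

Definition closed_gembedding (Y Z : gSpaceType G) (f : Y -> Z) : Prop :=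
  [/\ gmap f, embedding f & closed (range f)].

End GSpaces.

(* An invariant subset as a G-space: the sigma type [set_type A] with the
   subspace topology and the restricted action. The proof of invariance is an
   argument so that the G-space structure can be inferred from the type. *)
Definition gsubspace (G : topologicalGroupType) (X : gSpaceType G) (A : set X)
  (invA : invariant_set A) : Type := set_type A.

Section GSubspace.
Context {G : topologicalGroupType} {X : gSpaceType G} {A : set X}.
Variable invA : invariant_set A.

HB.instance Definition _ := Topological.copy (gsubspace invA) (set_type A).

Definition gsubspace_act (g : G) (a : gsubspace invA) : gsubspace invA :=
  exist _ (gact g (set_val a)) (mem_set (invA g (set_valP a))).

Lemma gsubspace_act1 a : gsubspace_act 1%g a = a.
Proof. by apply: val_inj; rewrite /= gact1. Qed.

Lemma gsubspace_actM g h a :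
  gsubspace_act (g * h)%g a = gsubspace_act g (gsubspace_act h a).
Proof. by apply: val_inj; rewrite /= gactM. Qed.

Lemma gsubspace_act_continuous :
  continuous (fun p : G * gsubspace invA => gsubspace_act p.1 p.2).
Proof.
apply/(@continuous_comp_initial _ _ _ set_val) => p.
apply: (@continuous_comp _ _ _
  (fun p : G * gsubspace invA => (p.1, set_val p.2))
  (fun q : G * X => gact q.1 q.2)); last exact: gact_continuous.
apply: cvg_pair; first exact: cvg_fst.
apply: (@continuous_comp _ _ _ snd (set_val : gsubspace invA -> X)).
  exact: cvg_snd.
exact: initial_continuous.
Qed.

HB.instance Definition _ := @isGSpace.Build G (gsubspace invA)
  gsubspace_act gsubspace_act1 gsubspace_actM gsubspace_act_continuous.

End GSubspace.

Definition unit_interval (R : realType) : Type :=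
  set_type (`[0, 1]%classic : set R).

HB.instance Definition _ (R : realType) :=
  Topological.copy (unit_interval R) (set_type (`[0, 1]%classic : set R)).

(* [X * I] with the action [g (x, t) = (g x, t)] *)
Definition cylinder (R : realType) (X : Type) : Type :=
  (X * unit_interval R)%type.

Section Cylinder.
Context (R : realType) {G : topologicalGroupType} (X : gSpaceType G).

HB.instance Definition _ :=
  Topological.copy (cylinder R X) (X * unit_interval R)%type.

Definition cylinder_act (g : G) (p : cylinder R X) : cylinder R X :=
  (gact g p.1, p.2).

Lemma cylinder_act1 p : cylinder_act 1%g p = p.
Proof. by case: p => x t; rewrite /cylinder_act /= gact1. Qed.

Lemma cylinder_actM g h p :
  cylinder_act (g * h)%g p = cylinder_act g (cylinder_act h p).
Proof. by rewrite /cylinder_act /= gactM. Qed.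

Lemma cylinder_act_continuous :
  continuous (fun p : G * cylinder R X => cylinder_act p.1 p.2).
Proof.
move=> q.
apply: (@cvg_pair _ _ _ (nbhs q) (nbhs (gact q.1 q.2.1)) (nbhs q.2.2)
  (nbhs_filter q) (nbhs_filter _) (nbhs_filter _)).
  apply: (@continuous_comp _ _ _
    (fun p : G * (X * unit_interval R) => (p.1, p.2.1))
    (fun r : G * X => gact r.1 r.2)); last exact: gact_continuous.
  apply: cvg_pair; first exact: cvg_fst.
  by apply: (@continuous_comp _ _ _ snd fst); [exact: cvg_snd|exact: cvg_fst].
by apply: (@continuous_comp _ _ _ snd snd); exact: cvg_snd.
Qed.

HB.instance Definition _ := @isGSpace.Build G (cylinder R X)
  cylinder_act cylinder_act1 cylinder_actM cylinder_act_continuous.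

End Cylinder.

Section GANR.
Context (R : realType) {G : topologicalGroupType}.

(* [Y] is identified with its image under the embedding [i], so the retraction
   has codomain [Y] and sends [i y] to [y]. *)
Definition G_ANR (Y : gSpaceType G) : Prop :=
  metrizable R Y /\
  forall (Z : gSpaceType G) (i : Y -> Z),
    metrizable R Z -> closed_gembedding i ->
    exists (U : set Z) (invU : invariant_set U),
      range i `<=` U^° /\
      exists r : gsubspace invU -> Y,
        gmap r /\
        forall (z : gsubspace invU) y, set_val z = i y -> r z = y.

Definition ghomotopy (X Y : gSpaceType G) (F : cylinder R X -> Y) : Prop :=
  gmap F.

Definition ghomotopy_dense (X : gSpaceType G) (A : set X) : Prop :=
  invariant_set A /\
  exists F : cylinder R X -> X,
    [/\ ghomotopy F,
        forall x (t : unit_interval R), set_val t = 0 -> F (x, t) = x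
      & forall x (t : unit_interval R), 0 < set_val t -> A (F (x, t))].

End GANR.

(* Main.v *)
Require Import Defs.
From HB Require Import structures.
From mathcomp Require Import all_boot all_order all_algebra.
From mathcomp Require Import all_classical all_reals all_analysis.
From mathcomp Require Import ring lra.

(* Let X be closed in Z and let F be the homotopy into A. Since A is a G-ANR,
   the map F : X x (0,1] -> A extends to a G-map Phi : V -> A on an invariant
   neighborhood V of X x (0,1] in Z x (0,1]. Let P be the set of the points
   (z,t) of V for which Phi(z,t) is t-close to some F(x,t) with x t-close to z.
   For an invariant continuous time lambda >= 0 vanishing exactly on X and such
   that (z, lambda z) lies in P for z off X, the map z |-> Phi(z, lambda z),
   completed by the identity on X, is a retraction; it is continuous at the
   points of X because F_0 = id.

   The extension property of G-ANRs comes from gluing: Y is mapped to a space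
   of functions on A by a formula of Hausdorff's, which extends the composite
   of f : C -> A with the Kuratowski embedding of A. The distance to C, added
   as one more coordinate, makes the copy of A closed, and a neighborhood of
   this copy retracts onto it. *)

Set Implicit Arguments.
Unset Strict Implicit.
Unset Printing Implicit Defensive.
Import Order.TTheory GRing.Theory Num.Theory.
Import numFieldNormedType.Exports.
Local Open Scope classical_set_scope.
Local Open Scope ring_scope.

(** * Invariant metrics *)

Section BoundedExtrema.
Context {R : realType}.

(* Adjoining 1 makes the infimum meaningful when [S] is empty. *)
Definition capped_inf (S : set R) : R := inf ([set 1] `|` S).

Lemma le_capped_inf (S : set R) (m : R) : (forall s, S s -> 0 <= s) ->
  m <= capped_inf S <-> m <= 1 /\ forall s, S s -> m <= s.
Proof.
move=> S0; have lbS : has_inf ([set 1] `|` S).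
  split; first by exists 1; left.
  by exists 0 => s [->|/S0 //]; exact: ler01.
split=> [le_m|[m1 mS]].
- split=> [|s Ss]; apply: le_trans le_m _; apply: ge_inf; try exact: lbS.2.
    by left.
  by right.
- by apply: lb_le_inf; [exists 1; left | move=> s [->|/mS]].
Qed.

Lemma capped_inf_ge0 (S : set R) :
  (forall s, S s -> 0 <= s) -> 0 <= capped_inf S.
Proof. by move=> S0; apply/le_capped_inf. Qed.

Lemma capped_inf_le1 (S : set R) :
  (forall s, S s -> 0 <= s) -> capped_inf S <= 1.
Proof.
by move=> S0; have [] := (le_capped_inf (capped_inf S) S0).1 (lexx _).
Qed.

Lemma capped_inf_le (S : set R) s :
  (forall s, S s -> 0 <= s) -> S s -> capped_inf S <= s.
Proof.
by move=> S0; have [_] := (le_capped_inf (capped_inf S) S0).1 (lexx _); apply.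
Qed.

Lemma capped_inf_lt (S : set R) (m : R) : (forall s, S s -> 0 <= s) ->
  capped_inf S < m -> m <= 1 -> exists2 s, S s & s < m.
Proof.
move=> S0 lt_m m1; apply: contrapT => nS.
suff : m <= capped_inf S by rewrite leNgt lt_m.
apply/le_capped_inf => //; split=> // s Ss; rewrite leNgt; apply/negP => sm.
by apply: nS; exists s.
Qed.

Lemma sup_range_le (I : Type) (i0 : I) (phi : I -> R) (m : R) :
  (forall i, phi i <= 1) -> sup (range phi) <= m <-> forall i, phi i <= m.
Proof.
move=> phi1; have ne : range phi !=set0 by exists (phi i0), i0.
split=> [le_m i|le_m].
- apply: le_trans le_m; apply: ub_le_sup; last by exists i.
  by exists 1 => _ [j _ <-].
- by apply: ge_sup => // _ [j _ <-].
Qed.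

End BoundedExtrema.

(** The bound by 1 keeps distance functions valued in the unit interval, and invariance makes the
    distance to an invariant set an invariant function. *)
Record bounded_gmetric (R : realType) (G : topologicalGroupType)
    (X : gSpaceType G) (d : X -> X -> R) : Prop := BoundedGMetric {
  gdistxx : forall x, d x x = 0;
  gdist_eq0 : forall x y, d x y = 0 -> x = y;
  gdistC : forall x y, d x y = d y x;
  gdist_triangle : forall y x z, d x z <= d x y + d y z;
  gdist_nbhs : forall x (B : set X),
    nbhs x B <-> exists2 e, 0 < e & [set y | d x y < e] `<=` B;
  gdist_le1 : forall x y, d x y <= 1;
  gdist_inv : forall g x y, d (gact g x) (gact g y) = d x y }.

Section BoundedGMetricTheory.
Context {R : realType} {G : topologicalGroupType} {X : gSpaceType G}.
Context {d : X -> X -> R} (dP : bounded_gmetric d).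

Lemma gdist_metrizable : metrizable R X.
Proof. by case: dP => *; exists d; split. Qed.

Lemma gdist_ge0 x y : 0 <= d x y.
Proof.
by have := gdist_triangle dP y x x; rewrite (gdistxx dP) (gdistC dP y x); lra.
Qed.

Lemma gdist_ball x e : 0 < e -> nbhs x [set y | d x y < e].
Proof. by move=> e0; apply/(gdist_nbhs dP); exists e. Qed.

End BoundedGMetricTheory.

Lemma gactK (G : topologicalGroupType) (X : gSpaceType G) (g : G) (x : X) :
  gact (g^-1)%g (gact g x) = x.
Proof. by rewrite -gactM mulVg gact1. Qed.

Lemma gactKV (G : topologicalGroupType) (X : gSpaceType G) (g : G) (x : X) :
  gact g (gact (g^-1)%g x) = x.
Proof. by rewrite -gactM mulgV gact1. Qed.

Lemma gact_continuousl (G : topologicalGroupType) (X : gSpaceType G) (x : X) :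
  continuous (fun g : G => gact g x).
Proof.
move=> g.
apply: (@continuous_comp _ _ _ (fun h : G => (h, x))
  (fun p : G * X => gact p.1 p.2)); last exact: gact_continuous.
by apply: cvg_pair; [exact: cvg_id | exact: cvg_cst].
Qed.

Lemma gact_continuousr (G : topologicalGroupType) (X : gSpaceType G) (g : G) :
  continuous (fun x : X => gact g x).
Proof.
move=> x.
apply: (@continuous_comp _ _ _ (fun y : X => (g, y))
  (fun p : G * X => gact p.1 p.2)); last exact: gact_continuous.
by apply: cvg_pair; [exact: cvg_cst | exact: cvg_id].
Qed.

Lemma interior_invariant (G : topologicalGroupType) (X : gSpaceType G)
  (S : set X) : invariant_set S -> invariant_set S°.
Proof.
move=> invS g x Sx; have Vgx : (S (gact (g^-1)%g (gact g x))) by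
  rewrite gactK; exact: interior_subset.
have : nbhs (gact g x) (gact (g^-1)%g @^-1` S).
  apply: gact_continuousr; rewrite gactK; exact: Sx.
by apply: filterS => y /= /(invS g); rewrite gactKV.
Qed.

(** Truncate a metric at 1 and take the supremum over all translates by G. Compactness of G is what
    makes the supremum induce the same topology. *)
Lemma bounded_gmetric_exists (R : realType) (G : topologicalGroupType)
  (X : gSpaceType G) : compact [set: G] -> metrizable R X ->
  exists d : X -> X -> R, bounded_gmetric d.
Proof.
move=> cG [d [d0 dsep dC dtri dnbhs]].
have dge0 x y : 0 <= d x y by have := dtri y x x; rewrite d0 (dC y x); lra.
pose b x y := Num.min 1 (d x y).
pose D x y := sup (range (fun g : G => b (gact g x) (gact g y))).
have DP x y m : D x y <= m <-> forall g, b (gact g x) (gact g y) <= m.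
  by apply: (sup_range_le 1%g) => g; rewrite /b ge_min lexx.
have bD x y g : b (gact g x) (gact g y) <= D x y.
  exact ((DP x y _).1 (lexx _) g).
have bD1 x y : b x y <= D x y by have := bD x y 1%g; rewrite !gact1.
exists D; split.
- move=> x; apply/eqP; rewrite eq_le; apply/andP; split.
    by apply/DP => g; rewrite /b d0 ge_min lexx orbT.
  by apply: le_trans (bD1 x x); rewrite /b d0 le_min lexx ler01.
- move=> x y Dxy; apply: dsep; have := bD1 x y; have := dge0 x y.
  by rewrite Dxy /b ge_min; lra.
- by move=> x y; congr sup; congr (_ @` _); apply/funext => g; rewrite /b dC.
- move=> y x z; apply/DP => g; have := bD x y g; have := bD y z g.
  have := dtri (gact g y) (gact g x) (gact g z).
  have := dge0 (gact g x) (gact g y); have := dge0 (gact g y) (gact g z).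
  by rewrite /b /Num.min; do 3!case: ifPn; rewrite -?leNgt; lra.
- move=> x B; split=> [/dnbhs[e e0 eB]|[e e0 eB]].
    exists (Num.min 1 e); first by rewrite lt_min ltr01.
    move=> y /= Dxy; apply: eB => /=.
    have := le_lt_trans (bD1 x y) Dxy.
    by rewrite /b /Num.min; do 2!case: ifPn; rewrite -?leNgt; lra.
  (* Near [(g, x)] both translates lie within [e / 4] of [gact g x]. Compactness gives one
     neighborhood of [x] for all [g]; the radius [e / 2] leaves room for the supremum, which only
     preserves weak inequalities. *)
  have e20 : 0 < e / 2 by lra.
  have cover g : [set: G] g -> \forall g' \near g & y \near x,
      b (gact g' x) (gact g' y) < e / 2.
    move=> _; have N : nbhs (gact g x) [set y | d (gact g x) y < e / 4].
      by apply/dnbhs; exists (e / 4) => //; lra.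
    have [[S T] /= [Sg Tx] ST] :
      nbhs (g, x) ((fun p : G * X => gact p.1 p.2) @^-1`
        [set y | d (gact g x) y < e / 4]) by exact: gact_continuous.
    exists (S, T) => //= -[g' y] /= [Sg' Ty].
    have /= := ST (g', x) (conj Sg' (nbhs_singleton Tx)).
    have /= := ST (g', y) (conj Sg' Ty).
    have := dtri (gact g x) (gact g' x) (gact g' y).
    rewrite (dC _ (gact g x)) /b /Num.min.
    by case: ifPn; rewrite -?leNgt; lra.
  have := (compact_near_coveringP _).1 cG _ _
    (fun y g => b (gact g x) (gact g y) < e / 2) (nbhs_filter x) cover.
  apply: filterS => y xy; apply: eB => /=.
  apply: (@le_lt_trans _ _ (e / 2)); last by lra.
  by apply/DP => g; apply: ltW; exact: xy g I.
- by move=> x y; apply/DP => g; rewrite /b ge_min lexx.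
- move=> g x y; apply/eqP; rewrite eq_le; apply/andP; split; apply/DP => h.
    by rewrite -!gactM; exact: bD.
  by rewrite -[x](gactK g) -[y](gactK g) -!(gactM h) !gactKV; exact: bD.
Qed.

(** Common source of the Lipschitz and monotonicity bounds on the infima below. *)
Lemma capped_inf_image_leD (R : realType) (I : Type) (P : set I)
    (phi psi : I -> R) (e : R) :
  0 <= e -> (forall i, 0 <= phi i) -> (forall i, 0 <= psi i) ->
  (forall i, phi i <= psi i + e) ->
  capped_inf [set phi i | i in P] <= capped_inf [set psi i | i in P] + e.
Proof.
move=> e0 phi0 psi0 le_e.
have phi0' s : [set phi i | i in P] s -> 0 <= s by case=> i _ <-.
have psi0' s : [set psi i | i in P] s -> 0 <= s by case=> i _ <-.
rewrite -lerBlDr; apply/le_capped_inf => //; split.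
  by have := capped_inf_le1 phi0'; lra.
move=> _ [i Pi <-]; have := le_e i.
have : capped_inf [set phi i | i in P] <= phi i.
  by apply: capped_inf_le => //; exists i.
by lra.
Qed.

(** With [k = a' / b'], clearing the denominator [b] leaves the errors [delta] and [k * delta]. As
    [k * m <= 1], each is at most [e * m / 2], so together they fit into [e * b]. *)
Lemma divr_near (R : realType) (a a' b b' m e delta : R) :
  0 < m -> m <= 1 -> m <= b -> m <= b' -> 0 <= a' -> a' <= 1 -> 0 < e ->
  a <= a' + delta -> `|b - b'| <= delta -> 2 * delta <= e * (m * m) ->
  a / b <= a' / b' + e.
Proof.
move=> m0 m1 mb mb' a'0 a'1 e0 aa' bb' dm.
have b0 : 0 < b by lra.
have b'0 : 0 < b' by lra.
have d0 : 0 <= delta by apply: le_trans bb'; exact: normr_ge0.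
rewrite ler_pdivrMr //; set k := a' / b'.
have a'E : a' = k * b' by rewrite /k mulfVK // gt_eqF.
have k0 : 0 <= k by rewrite /k divr_ge0 // ltW.
have km : k * m <= 1 by apply: le_trans a'1; rewrite a'E ler_wpM2l.
have kd : k * delta <= e * m / 2.
  rewrite -(ler_pM2r m0); have -> : k * delta * m = k * m * delta by ring.
  have -> : e * m / 2 * m = e * (m * m) / 2 by ring.
  by have : k * m * delta <= 1 * delta := ler_wpM2r d0 km; lra.
have em : e * m <= e * b by rewrite ler_pM2l.
have emm : e * (m * m) <= e * m by rewrite ler_pM2l // ler_piMl // ltW.
have kb : k * (b' - b) <= k * delta.
  by rewrite ler_wpM2l //; move: bb'; rewrite ler_norml; lra.
by rewrite mulrDl; move: kb; rewrite mulrBr -a'E; lra.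
Qed.

(** * Embeddings in terms of neighborhoods *)

Lemma embedding_nbhs (X Y : topologicalType) (f : X -> Y) (x : X) (N : set X) :
  embedding f -> nbhs x N ->
  exists2 M, nbhs (f x) M & forall y, M (f y) -> N y.
Proof.
move=> [_ injf /(_ N° (@open_interior _ N))[V oV fN]] Nx; exists V.
  apply: open_nbhs_nbhs; split=> //.
  by have [] : (range f `&` V) (f x) by rewrite -fN; exists x.
move=> y Vy; have : (f @` N°) (f y) by rewrite fN; split=> //; exists y.
by move=> [z Nz /injf <-]; exact: interior_subset.
Qed.

Lemma nbhs_embedding (X Y : topologicalType) (f : X -> Y) :
  continuous f -> injective f ->
  (forall x N, nbhs x N ->
    exists2 M, nbhs (f x) M & forall y, M (f y) -> N y) ->
  embedding f.
Proof.
move=> cf injf fN; split=> // U oU.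
exists (\bigcup_(W in [set W | open W /\ f @^-1` W `<=` U]) W).
  by apply: bigcup_open => W [].
apply/seteqP; split.
  move=> _ [x Ux <-]; split; first by exists x.
  have [M fxM MU] := fN x U (open_nbhs_nbhs (conj oU Ux)).
  exists M° => //; split; first exact: open_interior.
  by move=> y /interior_subset /MU.
by move=> _ [[x _ <-] [W [oW WU] Wx]]; exists x => //; exact: WU.
Qed.

(** * Metric G-spaces from actions by isometries *)

Record isometric_action (R : realType) (G : topologicalGroupType) (W : Type)
    (D : W -> W -> R) (a : G -> W -> W) : Prop := IsometricAction {
  iso_distxx : forall x, D x x = 0;
  iso_dist_eq0 : forall x y, D x y = 0 -> x = y;
  iso_distC : forall x y, D x y = D y x;
  iso_dist_triangle : forall y x z, D x z <= D x y + D y z;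
  iso_dist_le1 : forall x y, D x y <= 1;
  iso_act1 : forall x, a 1%g x = x;
  iso_actM : forall g h x, a (g * h)%g x = a g (a h x);
  iso_inv : forall g x y, D (a g x) (a g y) = D x y;
  iso_orbit : forall x g0 e, 0 < e ->
    \forall g \near g0, D (a g x) (a g0 x) < e }.

(** An alias of [W] that carries [H], so that the metric topology and the action can be inferred
    from the type. *)
Definition metric_gspace (R : realType) (G : topologicalGroupType) (W : Type)
  (D : W -> W -> R) (a : G -> W -> W) (H : isometric_action D a) : Type := W.

Section MetricGSpace.
Context {R : realType} {G : topologicalGroupType} {W : Type}.
Context {D : W -> W -> R} {a : G -> W -> W}.
Variable H : isometric_action D a.
Let M := metric_gspace H.

HB.instance Definition _ := gen_eqMixin M.
HB.instance Definition _ := gen_choiceMixin M.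
HB.instance Definition _ := isMetric.Build R M
  (iso_distxx H) (iso_dist_eq0 H) (iso_distC H) (iso_dist_triangle H).

Lemma metric_gspace_nbhs (x : M) (B : set M) :
  nbhs x B <-> exists2 e, 0 < e & [set y : M | D x y < e] `<=` B.
Proof.
rewrite -nbhs_ballE; split.
- by case=> e /= e0 eB; exists e => // y; rewrite -[D x y]/(mdist x y) => xy;
    apply: eB; rewrite ballEmdist.
- by case=> e e0 eB; exists e => //= y; rewrite ballEmdist; exact: eB.
Qed.

(** Go through [a g x0]: since [g] is an isometry, the first distance is that of [x] and [x0]; the
    second is controlled by continuity of the orbit map of [x0]. *)
Lemma metric_gspace_act_continuous :
  continuous (fun p : G * M => a p.1 p.2 : M).
Proof.
move=> [g0 x0] N /metric_gspace_nbhs[e e0 eN].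
have e20 : 0 < e / 2 by lra.
exists ([set g | D (a g x0) (a g0 x0) < e / 2], [set x : M | D x0 x < e / 2]).
  by split; [exact: (iso_orbit H) | apply/metric_gspace_nbhs; exists (e / 2)].
move=> [g x] /= [gg0 xx0]; apply: eN => /=.
rewrite (iso_distC H); have := iso_dist_triangle H (a g x0) (a g x) (a g0 x0).
by rewrite (iso_inv H) (iso_distC H x); lra.
Qed.

HB.instance Definition _ := @isGSpace.Build G M a
  (iso_act1 H) (iso_actM H) metric_gspace_act_continuous.

Lemma metric_gspaceP : bounded_gmetric (D : M -> M -> R).
Proof. by case: (H) => *; split=> //; exact: metric_gspace_nbhs. Qed.

End MetricGSpace.

(** * A function space containing A as a closed G-subspace *)

Section FunctionSpace.
Context {R : realType} {G : topologicalGroupType} {A : gSpaceType G}.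
Context {d : A -> A -> R} (dP : bounded_gmetric d).

Definition fun_act (g : G) (phi : option A -> R) : option A -> R :=
  phi \o omap (gact (g^-1)%g).

Definition fun_dist (phi psi : option A -> R) : R :=
  sup (range (fun t => `|phi t - psi t|)).

Definition kuratowski (a : A) : option A -> R := oapp (d a) 0.

Definition unit_valued (phi : option A -> R) : Prop :=
  forall t, 0 <= phi t <= 1.

(** Orbit maps of arbitrary bounded functions may be discontinuous in the sup metric, hence
    [att_orbit]. The condition [att_base] turns the copy of A into the zero set of a continuous
    coordinate. *)
Record attaching_fun (phi : option A -> R) : Prop := AttachingFun {
  att_unit : unit_valued phi;
  att_orbit : forall g0 e, 0 < e ->
    \forall g \near g0, fun_dist (fun_act g phi) (fun_act g0 phi) < e;
  att_base : phi None = 0 -> exists a, phi = kuratowski a }.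

Lemma fun_dist_le (phi psi : option A -> R) (m : R) :
  unit_valued phi -> unit_valued psi ->
  fun_dist phi psi <= m <-> forall t, `|phi t - psi t| <= m.
Proof.
move=> uphi upsi; apply: (sup_range_le None) => t.
by have := uphi t; have := upsi t; rewrite ler_norml; lra.
Qed.

Lemma fun_dist_ub (phi psi : option A -> R) t :
  unit_valued phi -> unit_valued psi -> `|phi t - psi t| <= fun_dist phi psi.
Proof. by move=> uphi upsi; move: t; apply/fun_dist_le. Qed.

Lemma fun_act1 phi : fun_act 1%g phi = phi.
Proof.
apply/funext => -[s|] //=; rewrite /fun_act /=.
by rewrite invg1 gact1.
Qed.

Lemma fun_actM g h phi : fun_act (g * h)%g phi = fun_act g (fun_act h phi).
Proof.
apply/funext => -[s|] //=; rewrite /fun_act /=.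
by rewrite invgM gactM.
Qed.

Lemma fun_act_unit g phi : unit_valued phi -> unit_valued (fun_act g phi).
Proof. by move=> uphi t; exact: uphi. Qed.

Lemma fun_dist_act g phi psi :
  unit_valued phi -> unit_valued psi ->
  fun_dist (fun_act g phi) (fun_act g psi) = fun_dist phi psi.
Proof.
have le h phi' psi' : unit_valued phi' -> unit_valued psi' ->
    fun_dist (fun_act h phi') (fun_act h psi') <= fun_dist phi' psi'.
  move=> u v; apply/fun_dist_le; try exact: fun_act_unit.
  by move=> t; exact: (fun_dist_ub (omap (gact (h^-1)%g) t)).
move=> u v; apply/eqP; rewrite eq_le le //=.
rewrite -{1}[phi]fun_act1 -{1}[psi]fun_act1 -(mulVg g) !fun_actM.
by apply: le; exact: fun_act_unit.
Qed.

Lemma kuratowski_unit a : unit_valued (kuratowski a).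
Proof.
by move=> [s|] /=; rewrite ?lexx ?ler01 // (gdist_ge0 dP) (gdist_le1 dP).
Qed.

Lemma kuratowski_act g a : kuratowski (gact g a) = fun_act g (kuratowski a).
Proof.
apply/funext => -[s|] //=; rewrite /fun_act /=.
by rewrite -[in LHS](gactKV g s) (gdist_inv dP).
Qed.

(** The triangle inequality gives the upper bound, and the coordinate [Some b] attains it. *)
Lemma kuratowski_dist a b : fun_dist (kuratowski a) (kuratowski b) = d a b.
Proof.
have ua := kuratowski_unit a; have ub := kuratowski_unit b.
apply/eqP; rewrite eq_le; apply/andP; split.
  apply/fun_dist_le => // -[s|] /=; last first.
    by rewrite subrr normr0 (gdist_ge0 dP).
  rewrite ler_norml; have := gdist_triangle dP b a s.
  by have := gdist_triangle dP a b s; rewrite (gdistC dP b a); lra.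
have := fun_dist_ub (Some b) ua ub.
by rewrite /= (gdistxx dP) subr0 ger0_norm // (gdist_ge0 dP).
Qed.

Lemma kuratowski_attaching a : attaching_fun (kuratowski a).
Proof.
split; [exact: kuratowski_unit | | by exists a] => g0 e e0.
have : nbhs (gact g0 a) [set b | d (gact g0 a) b < e] by exact: gdist_ball.
move=> /gact_continuousl; rewrite nbhs_simpl /=; apply: filterS => g /=.
by rewrite -!kuratowski_act kuratowski_dist (gdistC dP).
Qed.

(** The orbit map of [fun_act g phi] is that of [phi] after right translation by [g]. *)
Lemma fun_act_attaching g phi :
  attaching_fun phi -> attaching_fun (fun_act g phi).
Proof.
move=> [uphi ophi bphi]; split; first exact: fun_act_unit.
- move=> g0 e e0; have := ophi (g0 * g)%g e e0.
  have cg : continuous (fun h : G => (h * g)%g).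
    move=> h; apply: (@continuous_comp _ _ _ (fun k : G => (k, g))
      (fun p : G * G => (p.1 * p.2)%g)); last exact: mulg_continuous.
    by apply: cvg_pair; [exact: cvg_id | exact: cvg_cst].
  move=> /cg; rewrite nbhs_simpl /=; apply: filterS => h /=.
  by rewrite !fun_actM.
- by move=> /bphi[a ->]; exists (gact g a); rewrite kuratowski_act.
Qed.

(* The universal space in which [A] gets glued to other G-spaces: the [None]
   coordinate vanishes exactly on the isometric copy of [A]. *)
Definition attaching_space : Type := {phi | attaching_fun phi}.

Definition att_act (g : G) (w : attaching_space) : attaching_space :=
  exist _ _ (fun_act_attaching g (proj2_sig w)).

Definition att_dist (v w : attaching_space) : R :=
  fun_dist (proj1_sig v) (proj1_sig w).

Lemma att_inj (v w : attaching_space) : proj1_sig v = proj1_sig w -> v = w.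
Proof.
by case: v w => [v pv] [w pw] /= vw; subst w; rewrite (Prop_irrelevance pv pw).
Qed.

Lemma att_isometric : isometric_action att_dist att_act.
Proof.
have u (w : attaching_space) := att_unit (proj2_sig w).
split.
- move=> x; apply/eqP; rewrite eq_le; apply/andP; split.
    by apply/fun_dist_le => // t; rewrite subrr normr0.
  by apply: le_trans (fun_dist_ub None (u x) (u x)); exact: normr_ge0.
- move=> x y xy; apply: att_inj; apply/funext => t; apply/eqP.
  rewrite -subr_eq0 -normr_le0 -xy.
  exact: fun_dist_ub.
- move=> x y; rewrite /att_dist /fun_dist; congr (sup (_ @` _)).
  by apply/funext => t; rewrite distrC.
- move=> y x z; apply/fun_dist_le => // t.
  apply: le_trans (ler_distD (proj1_sig y t) _ _) _.
  by apply: lerD; exact: fun_dist_ub.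
- move=> x y; apply/fun_dist_le => // t.
  by have := u x t; have := u y t; rewrite ler_norml; lra.
- by move=> x; apply: att_inj; exact: fun_act1.
- by move=> g h x; apply: att_inj; exact: fun_actM.
- by move=> g x y; exact: fun_dist_act.
- by move=> x; exact: att_orbit (proj2_sig x).
Qed.

Definition att_gspace : Type := metric_gspace att_isometric.
HB.instance Definition _ :=
  GSpace.copy att_gspace (metric_gspace att_isometric).

Lemma att_gspaceP : bounded_gmetric (att_dist : att_gspace -> att_gspace -> R).
Proof. exact: metric_gspaceP. Qed.

Definition att_emb (a : A) : att_gspace := exist _ _ (kuratowski_attaching a).

Lemma att_emb_closed : closed_gembedding att_emb.
Proof.
have isom a b : att_dist (att_emb a) (att_emb b) = d a b.
  exact: kuratowski_dist.
have cont : continuous att_emb.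
  move=> a N /(gdist_nbhs att_gspaceP)[e e0 eN].
  rewrite nbhs_simpl /=; apply/(gdist_nbhs dP); exists e => // b ab.
  by apply: eN; rewrite /= isom.
split.
- split=> // g a; apply: att_inj; exact: kuratowski_act.
- apply: nbhs_embedding => //.
    move=> a b ab; apply: (gdist_eq0 dP).
    by rewrite -isom ab (gdistxx att_gspaceP).
  move=> a N /(gdist_nbhs dP)[e e0 eN].
  exists [set w : att_gspace | att_dist (att_emb a) w < e].
    exact: (gdist_ball att_gspaceP).
  by move=> b /=; rewrite isom; exact: eN.
- move=> w clw; have [uw _ bw] := proj2_sig w.
  suff /bw[a wa] : proj1_sig w None = 0 by exists a => //; exact: att_inj.
  (* Otherwise the ball about [w] whose radius is the [None] coordinate of [w] misses the copy of A,
     where that coordinate is 0. *)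
  apply: contrapT => /eqP w0.
  have w_gt0 : 0 < proj1_sig w None.
    by rewrite lt_def w0; have /andP[] := uw None.
  have [_ [[a _ <-]]] := clw _ (gdist_ball att_gspaceP w w_gt0).
  rewrite /= ltNge => /negP; apply.
  have := fun_dist_ub None uw (kuratowski_unit a).
  by rewrite /= subr0 ger0_norm // ltW.
Qed.

End FunctionSpace.

(** * The extension property of G-ANRs *)

Lemma set_type_nbhs (T : topologicalType) (S : set T) (a : set_type S)
    (N : set (set_type S)) : nbhs a N ->
  exists2 M, nbhs (set_val a : T) M
    & forall b : set_type S, M (set_val b) -> N b.
Proof.
rewrite !nbhsE => -[_ [[M oM <-] Ma] MN].
exists M; first by exists M.
by move=> b Mb; exact: MN.
Qed.

(** * Hausdorff's extension formula *)

Section AttachingMap.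
Context {R : realType} {G : topologicalGroupType} {A C Y : gSpaceType G}.
Context {d : A -> A -> R} (dP : bounded_gmetric d).
Context {rho : Y -> Y -> R} (rhoP : bounded_gmetric rho).
Context {j : C -> Y} (jP : closed_gembedding j).
Context {f : C -> A} (fP : gmap f).

Let h (y : Y) : R := capped_inf (range (fun c => rho y (j c))).

(** The term of Hausdorff's infimum for the coordinate [s]. Off the image of [j], the penalty added
    to [d (f c) s] is nonnegative, and it is small only if [j c] is nearly a closest point of the
    image to [y]. *)
Let excess (y : Y) (s : A) (c : C) : R := d (f c) s + rho y (j c) / h y - 1.

Definition attaching_map (y : Y) : option A -> R :=
  match pselect (exists c, j c = y) with
  | left ex => kuratowski (d := d) (f (projT1 (cid ex)))
  | right _ => oapp (fun s => capped_inf (range (excess y s))) (h y)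
  end.

Let rho0 y y' : 0 <= rho y y'. Proof. exact: gdist_ge0. Qed.

Let range_rho0 y s : range (fun c => rho y (j c)) s -> 0 <= s.
Proof. by case=> c _ <-. Qed.

Let j_inj c c' : j c = j c' -> c = c'.
Proof. by case: jP => _ [_ injj _] _; exact: injj. Qed.

Let j_act g c : j (gact g c) = gact g (j c). Proof. by case: jP => -[]. Qed.

Let f_act g c : f (gact g c) = gact g (f c). Proof. by case: fP. Qed.

Let h_ge0 y : 0 <= h y. Proof. by apply: capped_inf_ge0 => s /range_rho0. Qed.

Let h_le1 y : h y <= 1. Proof. by apply: capped_inf_le1 => s /range_rho0. Qed.

Let h_le y c : h y <= rho y (j c).
Proof. by apply: capped_inf_le; [exact: range_rho0 | exists c]. Qed.

Let h_lip y y' : h y <= h y' + rho y y'.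
Proof.
apply: capped_inf_image_leD => // c.
by rewrite addrC; exact: (gdist_triangle rhoP).
Qed.

Let h_norm y y' : `|h y - h y'| <= rho y y'.
Proof.
by rewrite ler_norml; have := h_lip y y'; have := h_lip y' y;
  rewrite (gdistC rhoP y' y); lra.
Qed.

Let h_gt0 y : (forall c, j c <> y) -> 0 < h y.
Proof.
move=> offy; rewrite lt_def h_ge0 andbT; apply/eqP => hy.
have [_ _ clj] := jP; have : range j y; last by case=> c _; exact: offy.
apply: clj => N /(gdist_nbhs rhoP)[e e0 eN].
have lt_e : h y < Num.min 1 e by rewrite hy lt_min ltr01.
have [|s [c _ <-]] := capped_inf_lt (range_rho0 (y := y)) lt_e.
  by rewrite ge_min lexx.
by rewrite lt_min => /andP[_ ce]; exists (j c); split; [exists c | exact: eN].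
Qed.

Let excess_ge y s c : (forall c, j c <> y) -> d (f c) s <= excess y s c.
Proof.
move=> /h_gt0 hy; rewrite /excess -addrA lerDl subr_ge0.
by rewrite ler_pdivlMr // mul1r.
Qed.

Let excess_ge0 y s c : (forall c, j c <> y) -> 0 <= excess y s c.
Proof. by move=> /(excess_ge s c); apply: le_trans; exact: gdist_ge0. Qed.

Let range_excess0 y s r : (forall c, j c <> y) ->
  range (excess y s) r -> 0 <= r.
Proof. by move=> offy [c _ <-]; exact: excess_ge0. Qed.

Lemma attaching_map_on c : attaching_map (j c) = kuratowski (d := d) (f c).
Proof.
rewrite /attaching_map; case: pselect => [ex|[]]; last by exists c.
by congr (kuratowski (f _)); apply: j_inj; exact: projT2 (cid ex).
Qed.

Let attaching_map_off y : (forall c, j c <> y) ->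
  attaching_map y = oapp (fun s => capped_inf (range (excess y s))) (h y).
Proof.
move=> offy; rewrite /attaching_map; case: pselect => // -[c jc].
by case: (offy c).
Qed.

Let on_or_off y : (exists c, j c = y) \/ (forall c, j c <> y).
Proof.
have [|n] := pselect (exists c, j c = y); [by left | right=> c jc].
by apply: n; exists c.
Qed.

Lemma attaching_map_unit y : unit_valued (attaching_map y).
Proof.
have [[c <-]|offy] := on_or_off y.
  by rewrite attaching_map_on; exact: kuratowski_unit.
rewrite attaching_map_off // => -[s|] /=; last by rewrite h_ge0 h_le1.
have r0 r : range (excess y s) r -> 0 <= r by exact: range_excess0.
by rewrite capped_inf_ge0 // capped_inf_le1.
Qed.

(** Off the closed image of [j] the [None] coordinate is the distance [h y], which is positive. *)
Lemma attaching_map_base y :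
  attaching_map y None = 0 -> exists a, attaching_map y = kuratowski (d := d) a.
Proof.
have [[c <-]|offy] := on_or_off y.
  by move=> _; exists (f c); rewrite attaching_map_on.
by rewrite attaching_map_off //= => h0; have := h_gt0 offy; rewrite h0 ltxx.
Qed.

Let h_act g y : h (gact g y) = h y.
Proof.
congr capped_inf; apply/seteqP; split=> _ [c _ <-].
  exists (gact (g^-1)%g c) => //.
  by rewrite j_act -{1}[y](gactK g) (gdist_inv rhoP).
by exists (gact g c) => //; rewrite j_act (gdist_inv rhoP).
Qed.

(** Translation by [g] reindexes the infimum over C, because both metrics are invariant. *)
Lemma attaching_map_act g y :
  attaching_map (gact g y) = fun_act g (attaching_map y).
Proof.
have [[c <-]|offy] := on_or_off y.
  by rewrite -j_act !attaching_map_on f_act kuratowski_act.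
have offgy c : j c <> gact g y.
  by move=> jc; apply: (offy (gact (g^-1)%g c)); rewrite j_act jc gactK.
rewrite !attaching_map_off //; apply/funext => -[s|] /=; last first.
  by rewrite /fun_act /= h_act.
rewrite /fun_act /=; congr capped_inf; apply/seteqP; split=> _ [c _ <-].
  exists (gact (g^-1)%g c) => //.
  rewrite /excess f_act j_act (gdist_inv dP) h_act.
  by rewrite -{1}[y](gactK g) (gdist_inv rhoP).
exists (gact g c) => //; rewrite /excess f_act j_act (gdist_inv rhoP) h_act.
by rewrite -{1}[s](gactKV g) (gdist_inv dP).
Qed.

(* Off the closed set the quotients [rho y (j c) / h y] are equicontinuous. *)
Let near_off y e : (forall c, j c <> y) -> 0 < e ->
  \forall y' \near y, forall t, `|attaching_map y' t - attaching_map y t| <= e.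
Proof.
move=> offy e0; have hy := h_gt0 offy; pose m := h y / 2.
have m0 : 0 < m by rewrite /m; lra.
have m1 : m <= 1 by rewrite /m; have := h_le1 y; lra.
(* The bound [m] keeps [h y'] above [m]; the other one is the smallness that [divr_near] asks
   for. *)
pose del := Num.min m (e * (m * m) / 2).
have del0 : 0 < del.
  by rewrite lt_min m0 /= divr_gt0 // !mulr_gt0.
apply: filterS (gdist_ball rhoP y del0) => y' /= yy'.
have delm : del <= m by rewrite ge_min lexx.
have dele : 2 * del <= e * (m * m).
  have : del <= e * (m * m) / 2 by rewrite ge_min lexx orbT.
  by lra.
have hyy' := h_norm y y'.
have hy' : m <= h y'.
  by move: hyy'; rewrite ler_norml; move: delm; rewrite /m; lra.
have mh : m <= h y by rewrite /m; lra.
have offy' c : j c <> y'.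
  move=> jc; have := h_le y' c; rewrite jc (gdistxx rhoP).
  by move: m0 hy'; lra.
have mm : m * m <= m by rewrite ler_piMl // ltW.
have tri1 c : rho y' (j c) <= rho y (j c) + del.
  by have := gdist_triangle rhoP y y' (j c); rewrite (gdistC rhoP y' y); lra.
have tri2 c : rho y (j c) <= rho y' (j c) + del.
  by have := gdist_triangle rhoP y' y (j c); lra.
rewrite !attaching_map_off // => -[s|] /=; last first.
  have : e * (m * m) <= e * 1 by rewrite ler_pM2l //; lra.
  by move: hyy'; rewrite distrC; lra.
have le1 c : excess y' s c <= excess y s c + e.
  rewrite /excess; have : rho y' (j c) / h y' <= rho y (j c) / h y + e.
    apply: (divr_near (m := m) (delta := del)) => //; first exact: gdist_le1.
    by rewrite distrC (le_trans hyy') // ltW.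
  by lra.
have le2 c : excess y s c <= excess y' s c + e.
  rewrite /excess; have : rho y (j c) / h y <= rho y' (j c) / h y' + e.
    apply: (divr_near (m := m) (delta := del)) => //; first exact: gdist_le1.
    by rewrite (le_trans hyy') // ltW.
  by lra.
have ex0 c : 0 <= excess y s c by exact: excess_ge0.
have ex0' c : 0 <= excess y' s c by exact: excess_ge0.
have := capped_inf_image_leD setT (ltW e0) ex0' ex0 le1.
have := capped_inf_image_leD setT (ltW e0) ex0 ex0' le2.
by rewrite ler_norml; lra.
Qed.

(* Points [c] with [rho y (j c) >= 2 * h y] do not lower the infimum since
   their excess is at least 1; the other ones are close to [c0]. *)
Let near_on c0 e : 0 < e ->
  \forall y \near j c0,
    forall t, `|attaching_map y t - attaching_map (j c0) t| <= e.
Proof.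
move=> e0; have e20 : 0 < e / 2 by lra.
have [cf _] := fP; have [[cj _] ej _] := jP.
have Nf : nbhs c0 [set c | d (f c0) (f c) < e / 2].
  exact: cf (gdist_ball dP (f c0) e20).
have [M jM MN] := embedding_nbhs ej Nf.
have [eta eta0 etaM] := (gdist_nbhs rhoP _ _).1 jM.
(* For [y] off the image, [h y < del], so [rho y (j c) < 2 * h y] puts [j c] within [3 * del <= eta]
   of [j c0]. The bound [e] serves the [None] coordinate. *)
pose del := Num.min (Num.min 1 e) (eta / 3).
have del0 : 0 < del by rewrite !lt_min ltr01 e0 /=; lra.
have del1 : del <= 1 by rewrite !ge_min lexx.
have dele : del <= e by rewrite !ge_min lexx orbT.
have deleta : del <= eta / 3 by rewrite !ge_min lexx !orbT.
apply: filterS (gdist_ball rhoP (j c0) del0) => y /= yc0.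
have fc c : rho (j c0) (j c) < eta -> d (f c0) (f c) < e / 2.
  by move=> c0c; apply: MN; exact: etaM.
have df c s : rho (j c0) (j c) < eta -> `|d (f c) s - d (f c0) s| <= e / 2.
  move=> /fc fcc; rewrite ler_norml.
  have := gdist_triangle dP (f c0) (f c) s; rewrite (gdistC dP (f c) (f c0)).
  by have := gdist_triangle dP (f c) (f c0) s; lra.
have [[c jc]|offy] := on_or_off y.
  rewrite -jc !attaching_map_on => -[s|] /=.
    by have := df c s; rewrite jc => /(_ _) le; apply: le_trans (le _) _; lra.
  by rewrite subrr normr0 ltW.
have hy := h_gt0 offy.
have hdel : h y < del.
  by apply: le_lt_trans yc0; rewrite (gdistC rhoP); exact: h_le.
have c_near c : rho y (j c) < 2 * h y -> rho (j c0) (j c) < eta.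
  by have := gdist_triangle rhoP y (j c0) (j c); lra.
rewrite attaching_map_off // attaching_map_on => -[s|] /=; last first.
  by rewrite subr0 ger0_norm // ltW // (lt_le_trans hdel).
have r0 r : range (excess y s) r -> 0 <= r by exact: range_excess0.
rewrite ler_norml; apply/andP; split.
  suff : d (f c0) s - e <= capped_inf (range (excess y s)) by lra.
  apply/le_capped_inf => //; split; first by have := gdist_le1 dP (f c0) s; lra.
  move=> _ [c _ <-]; have [near_c|far_c] := ltP (rho y (j c)) (2 * h y).
    have := excess_ge s c offy; have := df c s (c_near c near_c).
    by rewrite ler_norml; lra.
  have : 2 <= rho y (j c) / h y by rewrite ler_pdivlMr.
  rewrite /excess; have := gdist_le1 dP (f c0) s.
  by have := gdist_ge0 dP (f c) s; lra.
(* A nearly closest [c]: the factor 2 makes it near [c0], and the factor [1 + e / 2] makes its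
   penalty at most [e / 2]. *)
pose m := Num.min 1 (Num.min (2 * h y) ((1 + e / 2) * h y)).
have hm : h y < m.
  rewrite !lt_min (lt_le_trans hdel) //= ltr_pMl //.
  apply/andP; split; first lra.
  by rewrite ltr_pMl //; lra.
have [|_ [c _ <-]] := capped_inf_lt (range_rho0 (y := y)) hm.
  by rewrite ge_min lexx.
rewrite !lt_min => /and3P[_ /c_near/(df c s) + c2].
have : rho y (j c) / h y <= 1 + e / 2 by rewrite ler_pdivrMr // ltW.
have : capped_inf (range (excess y s)) <= excess y s c.
  by apply: capped_inf_le => //; exists c.
by rewrite {2}/excess ler_norml; lra.
Qed.

Lemma attaching_map_near y e : 0 < e ->
  \forall y' \near y, forall t, `|attaching_map y' t - attaching_map y t| <= e.
Proof.
have [[c <-]|offy] := on_or_off y; first exact: near_on.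
exact: near_off.
Qed.

(** By equivariance, the orbit map of [attaching_map y] is [attaching_map] after the orbit map of
    [y], so its continuity comes from [attaching_map_near]. *)
Lemma attaching_map_attaching y : attaching_fun (d := d) (attaching_map y).
Proof.
split; [exact: attaching_map_unit | | exact: attaching_map_base] => g0 e e0.
have e20 : 0 < e / 2 by lra.
have /gact_continuousl := attaching_map_near (gact g0 y) e20.
rewrite nbhs_simpl /=; apply: filterS => g /= le_e.
apply: (@le_lt_trans _ _ (e / 2)); last by lra.
rewrite -!attaching_map_act; apply/fun_dist_le => //.
  exact: attaching_map_unit.
exact: attaching_map_unit.
Qed.

Definition attach (y : Y) : att_gspace dP :=
  exist _ _ (attaching_map_attaching y).

Lemma attach_gmap : gmap attach.
Proof.
split=> [y N /(gdist_nbhs (att_gspaceP dP))[e e0 eN]|g y]; last first.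
  by apply: att_inj; exact: attaching_map_act.
rewrite nbhs_simpl /=; have e20 : 0 < e / 2 by lra.
apply: filterS (attaching_map_near y e20) => y' yy'; apply: eN => /=.
apply: (@le_lt_trans _ _ (e / 2)); last by lra.
apply/fun_dist_le; try exact: attaching_map_unit.
by move=> t; rewrite distrC; exact: yy'.
Qed.

Lemma attach_on c : attach (j c) = att_emb dP (f c).
Proof. by apply: att_inj; exact: attaching_map_on. Qed.

End AttachingMap.

(** The extension is [attach] followed by the retraction onto the copy of A. It is made a total
    function by the default value [a0], so continuity and equivariance are asserted at points of [V]
    only. *)
Lemma ganr_extension (R : realType) (G : topologicalGroupType)
    (A C Y : gSpaceType G) (j : C -> Y) (f : C -> A) :
  compact [set: G] -> G_ANR R A -> metrizable R Y ->
  closed_gembedding j -> gmap f -> forall a0 : A,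
  exists (V : set Y) (Phi : Y -> A),
    [/\ open V, invariant_set V, range j `<=` V
      & [/\ forall y, V y -> {for y, continuous Phi},
            forall g y, V y -> Phi (gact g y) = gact g (Phi y)
          & forall c, Phi (j c) = f c]].
Proof.
move=> cG [mA extA] mY jP fP a0.
have [d dP] := bounded_gmetric_exists cG mA.
have [rho rhoP] := bounded_gmetric_exists cG mY.
have [U [invU [embU [r [[cr ar] rE]]]]] :=
  extA _ _ (gdist_metrizable (att_gspaceP dP)) (att_emb_closed dP).
pose q := attach dP rhoP jP fP.
have [cq aq] : gmap q := attach_gmap dP rhoP jP fP.
pose Phi y := if pselect (U (q y)) is left Uq
  then r (exist _ (q y) (mem_set Uq)) else a0.
have PhiE (u : gsubspace invU) y : set_val u = q y -> Phi y = r u.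
  move=> uq; rewrite /Phi; case: pselect => [Uq|[]].
    by congr r; apply: val_inj; rewrite /= -uq.
  by rewrite -uq; exact: set_valP.
have qj c : q (j c) = att_emb dP (f c) by exact: attach_on.
exists (q @^-1` U°), Phi; split.
- by apply: open_comp; [move=> y _; exact: cq | exact: open_interior].
- by move=> g y Uqy; rewrite /= aq; exact: interior_invariant.
- by move=> _ [c _ <-]; rewrite /= qj; apply: embU; exists (f c).
split.
- move=> y Uqy N.
  pose u : gsubspace invU := exist _ (q y) (mem_set (interior_subset Uqy)).
  rewrite (PhiE u) // => /cr; rewrite nbhs_simpl /=.
  move=> /set_type_nbhs[M Mqy MN].
  have : nbhs (q y) (M `&` U) by apply: filterI.
  move=> /cq; rewrite nbhs_simpl /=; apply: filterS => y' /= [My' Uy'].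
  pose u' : gsubspace invU := exist _ (q y') (mem_set Uy').
  by rewrite (PhiE u') //; exact: MN.
- move=> g y /interior_subset Uqy.
  pose u : gsubspace invU := exist _ (q y) (mem_set Uqy).
  by rewrite (PhiE u y) // (PhiE (gact g u) (gact g y)) ?ar //= aq.
- move=> c; have Uq : U (att_emb dP (f c)).
    by apply: interior_subset; apply: embU; exists (f c).
  pose u : gsubspace invU := exist _ (att_emb dP (f c)) (mem_set Uq).
  by rewrite (PhiE u) ?qj //; exact: rE.
Qed.

(** * Choice of the time parameter *)

Section TimeSelection.
Context {R : realType} {G : topologicalGroupType} {Z : gSpaceType G}.
Context {d : Z -> Z -> R} (dP : bounded_gmetric d).
Context {X : set Z} (clX : closed X) (invX : invariant_set X).
Context {P : Z -> R -> Prop}.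
Hypothesis P_near : forall x (t : R), X x -> 0 < t <= 1 ->
  \forall s \near t & z \near x, 0 < s <= 1 -> P z s.
Hypothesis P_inv : forall g z t, P z t -> P (gact g z) t.

Let bad : set (Z * R) := [set p | 0 < p.2 <= 1 /\ ~ P p.1 p.2].

Let term (z : Z) (t : R) (p : Z * R) : R := Num.max (d z p.1) (t - p.2).

(* A one-sided distance to the complement of [P], hence nondecreasing in [t]. *)
Let gap (z : Z) (t : R) : R := capped_inf [set term z t p | p in bad].

Let gapX (z : Z) : R := capped_inf [set d z x | x in X].

(* On [sel_dom], [sel_time z] is the only solution [t] of [t * gap z t = gapX z]. *)
Definition sel_time (z : Z) : R :=
  sup [set t | 0 <= t <= 1 /\ t * gap z t <= gapX z].

(** The condition says that [t = 1] strictly violates the inequality in [sel_time]. It is open in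
    [z], and it holds on X, where [gapX] vanishes and [gap] is positive. *)
Definition sel_dom : set Z := [set z | gapX z < gap z 1].

Let d0 z z' : 0 <= d z z'. Proof. exact: gdist_ge0. Qed.

Let term0 z t p : 0 <= term z t p. Proof. by rewrite le_max d0. Qed.

Let image_term0 z t s : [set term z t p | p in bad] s -> 0 <= s.
Proof. by case=> p _ <-. Qed.

Let image_d0 z s : [set d z x | x in X] s -> 0 <= s.
Proof. by case=> x _ <-. Qed.

Let gap_ge0 z t : 0 <= gap z t.
Proof. by apply: capped_inf_ge0 => s /image_term0. Qed.

Let gap_le1 z t : gap z t <= 1.
Proof. by apply: capped_inf_le1 => s /image_term0. Qed.

Let gapX_ge0 z : 0 <= gapX z.
Proof. by apply: capped_inf_ge0 => s /image_d0. Qed.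

Let gapX_le1 z : gapX z <= 1.
Proof. by apply: capped_inf_le1 => s /image_d0. Qed.

Let gapX_lip z z' : gapX z <= gapX z' + d z z'.
Proof.
apply: capped_inf_image_leD => // x.
by rewrite addrC; exact: (gdist_triangle dP).
Qed.

Let gap_lip z z' t : gap z t <= gap z' t + d z z'.
Proof.
apply: capped_inf_image_leD => // p; rewrite /term ge_max.
have := gdist_triangle dP z' z p.1.
have : d z' p.1 <= Num.max (d z' p.1) (t - p.2) by rewrite le_max lexx.
have : t - p.2 <= Num.max (d z' p.1) (t - p.2) by rewrite le_max lexx orbT.
by have := d0 z z'; lra.
Qed.

Let gap_mono z s t : s <= t -> gap z s <= gap z t.
Proof.
move=> st; rewrite -[leRHS]addr0; apply: capped_inf_image_leD => // p.
rewrite addr0 /term ge_max le_max lexx /= le_max; apply/orP; right; lra.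
Qed.

Let gap_time z s t : s <= t -> gap z t <= gap z s + (t - s).
Proof.
move=> st; apply: capped_inf_image_leD => //; first lra.
move=> p; rewrite /term ge_max.
have : d z p.1 <= Num.max (d z p.1) (s - p.2) by rewrite le_max lexx.
have : s - p.2 <= Num.max (d z p.1) (s - p.2) by rewrite le_max lexx orbT.
by lra.
Qed.

Let gap_act g z t : gap (gact g z) t = gap z t.
Proof.
have le h y : gap y t <= gap (gact h y) t.
  apply/le_capped_inf; first exact: image_term0.
  split=> // _ [p [p2 nP] <-]; apply: capped_inf_le; first exact: image_term0.
  exists (gact (h^-1)%g p.1, p.2).
    by split=> // /(P_inv h); rewrite /= gactKV.
  by rewrite /term /= -{1}[y](gactK h) (gdist_inv dP).
apply/eqP; rewrite eq_le le andbT.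
by have := le (g^-1)%g (gact g z); rewrite gactK.
Qed.

Let gapX_act g z : gapX (gact g z) = gapX z.
Proof.
have le h y : gapX y <= gapX (gact h y).
  apply/le_capped_inf; first exact: image_d0.
  split=> // _ [x Xx <-]; apply: capped_inf_le; first exact: image_d0.
  exists (gact (h^-1)%g x); first exact: invX.
  by rewrite -{1}[y](gactK h) (gdist_inv dP).
apply/eqP; rewrite eq_le le andbT.
by have := le (g^-1)%g (gact g z); rewrite gactK.
Qed.

Let gap_gt0P z t : 0 < t <= 1 -> 0 < gap z t -> P z t.
Proof.
move=> t01 gap0; apply: contrapT => nP; move: gap0; rewrite ltNge => /negP[].
apply: capped_inf_le; first exact: image_term0.
by exists (z, t) => //; rewrite /term /= (gdistxx dP) subrr maxxx.
Qed.

Let gapX_in z : X z -> gapX z = 0.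
Proof.
move=> Xz; apply/eqP; rewrite eq_le gapX_ge0 andbT -(gdistxx dP z).
by apply: capped_inf_le; [exact: image_d0 | exists z].
Qed.

Let gapX_off z : ~ X z -> 0 < gapX z.
Proof.
move=> nX; rewrite lt_def gapX_ge0 andbT; apply/eqP => z0; apply: nX.
apply: clX => N /(gdist_nbhs dP)[e e0 eN].
have lt_e : gapX z < Num.min 1 e by rewrite z0 lt_min ltr01.
have [|s [x Xx <-]] := capped_inf_lt (image_d0 (z := z)) lt_e.
  by rewrite ge_min lexx.
by rewrite lt_min => /andP[_ xe]; exists x; split=> //; exact: eN.
Qed.

(* Compactness of [[t / 2, 1]] gives a neighborhood of [x] that is uniform in
   the time parameter. *)
Let gap_gt0 x t : X x -> 0 < t <= 1 -> 0 < gap x t.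
Proof.
move=> Xx /andP[t0 t1].
have cK : compact (`[t / 2, 1]%classic : set R) by exact: segment_compact.
have cover s : `[t / 2, 1]%classic s ->
    \forall s' \near s & z \near x, `[t / 2, 1]%classic s' -> P z s'.
  rewrite /= in_itv /= => /andP[ts s1].
  have s01 : 0 < s <= 1 by lra.
  apply: filterS (P_near Xx s01) => -[s' z] /= Pz.
  by rewrite in_itv /= => /andP[ts' s'1]; apply: Pz; lra.
have /(gdist_nbhs dP)[e e0 eP] := (near_covering_withinP _).2
  ((compact_near_coveringP _).1 cK) _ _ _ (nbhs_filter x) cover.
(* A bad pair with time below [t / 2] contributes at least [t / 2] through its time; any other one
   lies at distance at least [e] from [x]. *)
apply: (@lt_le_trans _ _ (Num.min 1 (Num.min e (t / 2)))).
  by rewrite !lt_min ltr01 e0 /=; lra.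
apply/le_capped_inf; first exact: image_term0.
split=> [|_ [[z s] [/= /andP[s0 s1] nP] <-]]; first by rewrite ge_min lexx.
rewrite /term /= le_max; apply/orP.
have [ts|st] := leP (t / 2) s; last first.
  right; apply: (@le_trans _ _ (t / 2)); last by lra.
  by rewrite !ge_min lexx !orbT.
have [xz|ez] := ltP (d x z) e; last first.
  by left; apply: le_trans ez; rewrite !ge_min lexx !orbT.
by case: nP; apply: (eP z) => //=; rewrite in_itv /= ts s1.
Qed.

Let sel_set z := [set t | 0 <= t <= 1 /\ t * gap z t <= gapX z].

Let sel_sup z : has_sup (sel_set z).
Proof.
split; last by exists 1 => t [/andP[]].
by exists 0; split; rewrite ?lexx ?ler01 // mul0r.
Qed.

Let sel_ge z t : 0 <= t <= 1 -> t * gap z t <= gapX z -> t <= sel_time z.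
Proof. by move=> t01 tz; apply: ub_le_sup; [case: (sel_sup z) | split]. Qed.

(** As [t * gap z t] is nondecreasing in [t >= 0], [sel_set z] contains every nonnegative time below
    its supremum. *)
Let sel_lt z t : 0 <= t -> t < sel_time z -> t * gap z t <= gapX z.
Proof.
move=> t0 /(sup_gt (sel_sup z).1)[s [/andP[s0 s1] sz] /ltW ts].
by apply: le_trans sz; apply: ler_pM => //; exact: gap_mono.
Qed.

Lemma sel_time_le1 z : sel_time z <= 1.
Proof. by apply: ge_sup; [case: (sel_sup z) | move=> t [/andP[]]]. Qed.

(** Since [gap] is at most 1, the time [gapX z] itself belongs to [sel_set z]. This makes the
    selected time positive off X. *)
Let sel_time_gapX z : gapX z <= sel_time z.
Proof. by apply: sel_ge; rewrite ?gapX_ge0 ?gapX_le1 // ler_piMr. Qed.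

Lemma sel_time_ge0 z : 0 <= sel_time z.
Proof. exact: le_trans (sel_time_gapX z). Qed.

Lemma sel_time_off z : ~ X z -> 0 < sel_time z.
Proof. by move=> /gapX_off /lt_le_trans; apply. Qed.

(** Otherwise half the supremum would be a positive [t] with [t * gap x t <= 0], against
    [gap_gt0]. *)
Lemma sel_time_in x : X x -> sel_time x = 0.
Proof.
move=> Xx; apply/eqP; rewrite eq_le sel_time_ge0 andbT leNgt; apply/negP => l0.
have t0 : 0 < sel_time x / 2 by lra.
have t1 : 0 < sel_time x / 2 <= 1 by have := sel_time_le1 x; lra.
have := @sel_lt x (sel_time x / 2) (ltW t0); rewrite gapX_in // => le0.
by have := mulr_gt0 t0 (gap_gt0 Xx t1); rewrite ltNge le0 //; lra.
Qed.

Lemma sel_time_act g z : sel_time (gact g z) = sel_time z.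
Proof.
rewrite /sel_time gapX_act; congr sup.
by apply/seteqP; split=> t /=; rewrite gap_act.
Qed.

Lemma sel_dom_act : invariant_set sel_dom.
Proof. by move=> g z; rewrite /sel_dom /= gapX_act gap_act. Qed.

Lemma sel_dom_sub : X `<=` sel_dom.
Proof.
by move=> x Xx; rewrite /sel_dom /= gapX_in // gap_gt0 // ltr01 lexx.
Qed.

Lemma sel_dom_open : open sel_dom.
Proof.
rewrite openE => z; rewrite /sel_dom /= => zU.
have e0 : 0 < (gap z 1 - gapX z) / 2 by lra.
apply: filterS (gdist_ball dP z e0) => z' /= zz'.
have := gap_lip z z' 1; have := gapX_lip z' z.
by rewrite (gdistC dP z'); lra.
Qed.

(** It suffices that the gap is positive at the selected time. At time 1 this is [sel_dom]. Earlier,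
    a vanishing gap would be at most [e] at time [sel_time z + e], so for [e <= gapX z] that later
    time would belong to [sel_set z] too. *)
Lemma sel_timeP z : sel_dom z -> ~ X z -> P z (sel_time z).
Proof.
move=> zU nX; have l0 := sel_time_off nX; have l1 := sel_time_le1 z.
apply: gap_gt0P; first by rewrite l0 l1.
have [l_lt1|l_ge1] := ltP (sel_time z) 1; last first.
  have -> : sel_time z = 1 by lra.
  by apply: le_lt_trans zU; exact: gapX_ge0.
rewrite lt_def gap_ge0 andbT; apply/eqP => gap0.
have g0 := gapX_off nX.
pose e := Num.min (gapX z) (1 - sel_time z).
have e0 : 0 < e by rewrite lt_min g0 /=; lra.
have eg : e <= gapX z by rewrite ge_min lexx.
have e1 : e <= 1 - sel_time z by rewrite ge_min lexx orbT.
have le_t : sel_time z <= sel_time z + e by lra.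
have := gap_time z le_t; rewrite gap0 => gape.
suff : sel_time z + e <= sel_time z by lra.
apply: sel_ge; first by lra.
apply: le_trans eg; apply: (@le_trans _ _ (1 * e)); last by rewrite mul1r.
by apply: ler_pM => //; lra.
Qed.

(** Slightly above [sel_time z] the defining inequality fails; slightly below, it holds strictly.
    Both facts persist at [z'] near [z], as [gap] and [gapX] are Lipschitz in the point. *)
Lemma sel_time_near z e : 0 < e ->
  \forall z' \near z, `|sel_time z' - sel_time z| < e.
Proof.
move=> e0.
have gap_near t z' : 0 <= t -> t <= 1 -> t * gap z t <= t * gap z' t + d z z'.
  move=> t0 t1; have := ler_wpM2l t0 (gap_lip z z' t).
  by rewrite mulrDr; have := ler_wpM2r (d0 z z') t1; lra.
have gap_near' t z' : 0 <= t -> t <= 1 -> t * gap z' t <= t * gap z t + d z z'.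
  move=> t0 t1; have := ler_wpM2l t0 (gap_lip z' z t).
  rewrite mulrDr (gdistC dP z').
  by have := ler_wpM2r (d0 z z') t1; lra.
have upper : \forall z' \near z, sel_time z' < sel_time z + e.
  have [lt1|ge1] := ltP 1 (sel_time z + e).
    by apply: nearW => z'; apply: le_lt_trans lt1; exact: sel_time_le1.
  pose t := sel_time z + e / 2.
  have t0 : 0 <= t by have := sel_time_ge0 z; rewrite /t; lra.
  have t1 : t <= 1 by rewrite /t; lra.
  have tz : gapX z < t * gap z t.
    rewrite ltNge; apply/negP => /sel_ge; rewrite t0 t1 /t => /(_ isT); lra.
  have e'0 : 0 < (t * gap z t - gapX z) / 2 by lra.
  apply: filterS (gdist_ball dP z e'0) => z' /= zz'.
  apply: (@le_lt_trans _ _ t); last by rewrite /t; lra.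
  rewrite leNgt; apply/negP => /(sel_lt t0).
  have := gapX_lip z' z; rewrite (gdistC dP z').
  by have := gap_near t z' t0 t1; lra.
have lower : \forall z' \near z, sel_time z - e < sel_time z'.
  have [lt0|ge0] := ltP (sel_time z - e) 0.
    by apply: nearW => z'; apply: lt_le_trans lt0 _; exact: sel_time_ge0.
  have l1 := sel_time_le1 z.
  pose t := sel_time z - e / 2.
  have t0 : 0 < t by rewrite /t; lra.
  have t1 : t <= 1 by rewrite /t; lra.
  have nX : ~ X z by move=> /sel_time_in; lra.
  have tz : t * gap z t < gapX z.
    (* The intermediate time gives strictness at [t]: either [gap z s > 0] and the factor [t < s] is
       strict, or the gap vanishes at [t] while [gapX z > 0]. *)
    pose s := sel_time z - e / 4.
    have ts : t < s by rewrite /t /s; lra.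
    have s0 : 0 <= s by lra.
    have sz : s * gap z s <= gapX z by apply: sel_lt => //; rewrite /s; lra.
    have := gap_mono z (ltW ts).
    have [gap0|gap_pos] := leP (gap z s) 0.
      move=> gapt; have -> : gap z t = 0.
        by apply/eqP; rewrite eq_le gap_ge0 andbT; lra.
      by rewrite mulr0; exact: gapX_off.
    move=> gapt; apply: lt_le_trans sz.
    apply: (@le_lt_trans _ _ (t * gap z s)); first by rewrite ler_pM2l.
    by rewrite ltr_pM2r.
  have e'0 : 0 < (gapX z - t * gap z t) / 2 by lra.
  apply: filterS (gdist_ball dP z e'0) => z' /= zz'.
  apply: (@lt_le_trans _ _ t); first by rewrite /t; lra.
  apply: sel_ge; first by rewrite t1 ltW.
  have := gapX_lip z z'.
  by have := gap_near' t z' (ltW t0) t1; lra.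
near=> z'; rewrite ltr_norml; apply/andP; split.
  by rewrite ltrBrDr addrC; near: z'.
by rewrite ltrBlDl; near: z'.
Unshelve. all: by end_near. Qed.

End TimeSelection.

(** * The neighborhood retraction *)

(** The interval (0, 1] as a bare type; its topology enters through [timed_dist]. *)
Record pos_time (R : realType) : Type :=
  PosTime { time_val : R; _ : 0 < time_val <= 1 }.

Lemma pos_time_inj (R : realType) (s t : pos_time R) :
  time_val s = time_val t -> s = t.
Proof.
by case: s t => [s ps] [t pt] /= st; subst t; rewrite (Prop_irrelevance ps pt).
Qed.

Lemma pos_time_gt0 (R : realType) (t : pos_time R) : 0 < time_val t.
Proof. by case: t => t /= /andP[]. Qed.

Lemma pos_time_unit (R : realType) (t : pos_time R) :
  time_val t \in (`[0, 1]%classic : set R).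
Proof. by apply/mem_set; rewrite /= in_itv /=; case: t => t /=; lra. Qed.

Definition unit_time (R : realType) (t : pos_time R) : unit_interval R :=
  exist _ (time_val t) (pos_time_unit t).

(** * The cylinder over (0, 1] as a metric G-space *)

Section OpenCylinder.
Context {R : realType} {G : topologicalGroupType} {X : gSpaceType G}.
Context {d : X -> X -> R} (dP : bounded_gmetric d).

Definition timed_dist (p q : X * pos_time R) : R :=
  Num.max (d p.1 q.1) `|time_val p.2 - time_val q.2|.

Definition timed_act (g : G) (p : X * pos_time R) : X * pos_time R :=
  (gact g p.1, p.2).

Lemma timed_isometric : isometric_action timed_dist timed_act.
Proof.
split.
- by move=> p; rewrite /timed_dist (gdistxx dP) subrr normr0 maxxx.
- move=> [x s] [y t] xy; have := gdist_ge0 dP x y.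
  have : d x y <= 0 by rewrite -xy /timed_dist le_max lexx.
  have st : `|time_val s - time_val t| <= 0.
    by rewrite -xy /timed_dist le_max lexx orbT.
  move=> le0 ge0; congr (_, _); first by apply: (gdist_eq0 dP); lra.
  by apply: pos_time_inj; apply/eqP; rewrite -subr_eq0 -normr_le0.
- by move=> p q; rewrite /timed_dist (gdistC dP) distrC.
- move=> q p r; rewrite /timed_dist ge_max; apply/andP; split.
    apply: le_trans (gdist_triangle dP q.1 p.1 r.1) _.
    by apply: lerD; rewrite le_max lexx.
  apply: le_trans (ler_distD (time_val q.2) _ _) _.
  by apply: lerD; rewrite le_max lexx orbT.
- move=> [x [s s01]] [y [t t01]]; rewrite /timed_dist ge_max (gdist_le1 dP) /=.
  by rewrite ler_norml; lra.
- by move=> [x t]; rewrite /timed_act /= gact1.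
- by move=> g h [x t]; rewrite /timed_act /= gactM.
- by move=> g p q; rewrite /timed_dist /= (gdist_inv dP).
- move=> [x t] g0 e e0; rewrite /timed_dist /=.
  have := gdist_ball dP (gact g0 x) e0.
  move=> /gact_continuousl; rewrite nbhs_simpl /=; apply: filterS => g /=.
  by rewrite subrr normr0 gt_max e0 andbT (gdistC dP).
Qed.

Definition open_cylinder : Type := metric_gspace timed_isometric.
HB.instance Definition _ :=
  GSpace.copy open_cylinder (metric_gspace timed_isometric).

Lemma open_cylinderP :
  bounded_gmetric (timed_dist : open_cylinder -> open_cylinder -> R).
Proof. exact: metric_gspaceP. Qed.

Lemma open_cylinder_cylinder_continuous :
  continuous (fun p : open_cylinder => (p.1, unit_time p.2) : cylinder R X).
Proof.
move=> p; apply: (@cvg_pair _ _ _ (nbhs p) (nbhs p.1) (nbhs (unit_time p.2))).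
- move=> N /(gdist_nbhs dP)[e e0 eN]; rewrite nbhs_simpl /=.
  apply: filterS (gdist_ball open_cylinderP p e0) => q /=.
  by rewrite /timed_dist gt_max => /andP[pq _]; exact: eN.
- move=> N /set_type_nbhs[M /= Mt MN]; rewrite nbhs_simpl /=.
  have /nbhs_ballP[e /= e0 eM] := Mt.
  apply: filterS (gdist_ball open_cylinderP p e0) => q /=.
  by rewrite /timed_dist gt_max => /andP[_ pq]; apply: MN; exact: eM.
Qed.

End OpenCylinder.

Section CylinderMap.
Context {R : realType} {G : topologicalGroupType} {X Z : gSpaceType G}.
Context {d : X -> X -> R} (dP : bounded_gmetric d).
Context {rho : Z -> Z -> R} (rhoP : bounded_gmetric rho).
Context {i : X -> Z} (iP : closed_gembedding i).

Definition cylinder_map (p : open_cylinder dP) : open_cylinder rhoP :=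
  (i p.1, p.2).

Lemma cylinder_map_closed : closed_gembedding cylinder_map.
Proof.
have [[ci ai] ei cli] := iP; have [_ inji _] := ei.
have CP := open_cylinderP dP; have ZP := open_cylinderP rhoP.
have cj : continuous cylinder_map.
  move=> [x t] N /(gdist_nbhs ZP)[e e0 eN]; rewrite nbhs_simpl /=.
  have /ci := gdist_ball rhoP (i x) e0.
  rewrite nbhs_simpl /= => /(gdist_nbhs dP)[e' e'0 e'i].
  apply/(gdist_nbhs CP); exists (Num.min e e'); first by rewrite lt_min e0.
  move=> [y s] /=; rewrite /timed_dist /= gt_max !lt_min => /andP[/andP[_ xy]].
  move=> /andP[ts _]; apply: eN; rewrite /= /timed_dist /= gt_max ts andbT.
  exact: e'i.
split.
- by split=> // g [x t]; rewrite /cylinder_map /= ai.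
- apply: nbhs_embedding => //.
    by move=> [x s] [y t] [/inji -> ->].
  move=> [x t] N /(gdist_nbhs CP)[e e0 eN].
  have [M /(gdist_nbhs rhoP)[e' e'0 e'M] MN] :=
    embedding_nbhs ei (gdist_ball dP x e0).
  exists [set q : open_cylinder rhoP |
      timed_dist (d := rho) (i x, t) q < Num.min e e'].
    by apply: (gdist_ball ZP); rewrite lt_min e0.
  move=> [y s] /=; rewrite /timed_dist /= gt_max !lt_min => /andP[/andP[_ xy]].
  move=> /andP[ts _]; apply: eN; rewrite /= /timed_dist /= gt_max ts andbT.
  exact/MN/e'M.
- move=> [z t] clz; have [x _ xz] : range i z; last first.
    by exists (x, t); rewrite /cylinder_map /= ?xz.
  apply: cli => N /(gdist_nbhs rhoP)[e e0 eN].
  have [_ [[[x s] _ <-]]] := clz _ (gdist_ball ZP (z, t) e0).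
  rewrite /= /timed_dist /= gt_max => /andP[xz _].
  by exists (i x); split; [exists x | exact: eN].
Qed.

End CylinderMap.

(** * Construction of the retraction *)

Section NeighborhoodRetraction.
Context {R : realType} {G : topologicalGroupType} {X : gSpaceType G}.
Context {A : set X} (invA : invariant_set A).
Context {F : cylinder R X -> X} (FP : ghomotopy F).
Hypothesis F0 : forall x (t : unit_interval R), set_val t = 0 -> F (x, t) = x.
Hypothesis FA : forall x (t : unit_interval R), 0 < set_val t -> A (F (x, t)).

Lemma homotopy_restriction (d : X -> X -> R) (dP : bounded_gmetric d) :
  exists2 f : open_cylinder dP -> gsubspace invA, gmap f
    & forall p, set_val (f p) = F (p.1, unit_time p.2).
Proof.
have fA (p : open_cylinder dP) : F (p.1, unit_time p.2) \in A.
  by apply: mem_set; apply: FA; exact: pos_time_gt0.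
exists (fun p => exist _ (F (p.1, unit_time p.2)) (fA p)) => //.
have [cF aF] := FP; split.
  apply/(@continuous_comp_initial _ _ _ set_val) => p.
  apply: (@continuous_comp _ _ _
    (fun p : open_cylinder dP => (p.1, unit_time p.2) : cylinder R X) F).
    exact: open_cylinder_cylinder_continuous.
  exact: cF.
by move=> g p; apply: val_inj; rewrite /= -aF.
Qed.

Lemma ganr_neighborhood_retract (Z : gSpaceType G) (i : X -> Z) (x0 : X) :
  compact [set: G] -> metrizable R X -> G_ANR R (gsubspace invA) ->
  metrizable R Z -> closed_gembedding i ->
  exists (U : set Z) (invU : invariant_set U),
    range i `<=` U° /\
    exists r : gsubspace invU -> X,
      gmap r /\ forall (z : gsubspace invU) y, set_val z = i y -> r z = y.
Proof.
move=> cG mX anrA mZ iP.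
have [d dP] := bounded_gmetric_exists cG mX.
have [rho rhoP] := bounded_gmetric_exists cG mZ.
have [f fP fE] := homotopy_restriction dP.
have [[cF aF] [[ci ai] ei cli]] := (FP, iP); have [_ inji _] := ei.
have CP := open_cylinderP dP; have YP := open_cylinderP rhoP.
pose j := @cylinder_map _ _ _ _ _ dP _ rhoP i.
have one01 : 0 < (1 : R) <= 1 by rewrite ltr01 lexx.
have [V [Phi [oV invV jV [cPhi aPhi PhiE]]]] := ganr_extension cG anrA
  (gdist_metrizable YP)
  (cylinder_map_closed dP rhoP iP : closed_gembedding j) fP
  (f (x0, PosTime one01)).
(* Quantifying over [y] lets [P] take a bare real [t], as [sel_time] requires. The point [x] ties
   [Phi] to the homotopy and yields continuity at X. *)
pose P z t := exists y : open_cylinder rhoP,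
  [/\ y.1 = z, time_val y.2 = t, V y & exists x, rho z (i x) < t /\
    d (set_val (Phi y)) (F (x, unit_time y.2)) < t].
have cval : continuous (set_val : gsubspace invA -> X).
  exact: initial_continuous.
have P_inv g z t : P z t -> P (gact g z) t.
  move=> [y [yz yt Vy [x [zx yx]]]]; exists (gact g y); split=> //.
  - by rewrite -yz.
  - exact: invV.
  exists (gact g x); split; first by rewrite ai (gdist_inv rhoP).
  rewrite aPhi //=.
  rewrite -[F _]/(F (gact g ((x, unit_time y.2) : cylinder R X))).
  by rewrite aF (gdist_inv dP).
have P_near z (t : R) : range i z -> 0 < t <= 1 ->
    \forall s \near t & z' \near z, 0 < s <= 1 -> P z' s.
  move=> [x _ <-] t01; have /andP[t0 t1] := t01.
  (* For [s > t / 2] it suffices that [Phi] at [(z', s)] and [F] at [(x, s)] are both within [t / 4]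
     of [F] at [(x, t)]. *)
  have t40 : 0 < t / 4 by lra.
  pose c : open_cylinder dP := (x, PosTime t01).
  pose N : set (gsubspace invA) :=
    [set a | d (set_val (f c)) (set_val a) < t / 4].
  have Nfc : nbhs (f c) N.
    have := gdist_ball dP (set_val (f c)) t40; exact: cval.
  have /(fP.1 c)/(gdist_nbhs CP)[e1 e10 e1N] := Nfc.
  have Vc : V (j c) by apply: jV; exists c.
  have : nbhs (Phi (j c)) N by rewrite PhiE.
  move=> /(cPhi _ Vc) PhiN.
  have : nbhs (j c) (Phi @^-1` N `&` V).
    by apply: filterI => //; exact: open_nbhs_nbhs.
  move=> /(gdist_nbhs YP)[e2 e20 e2N].
  pose e := Num.min (t / 2) (Num.min e1 e2).
  have e0 : 0 < e by rewrite !lt_min e10 e20; lra.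
  exists ([set s | `|t - s| < e], [set z' | rho (i x) z' < e]).
    split; last exact: (gdist_ball rhoP).
    exact: (nbhsx_ballx t e e0).
  move=> [s z'] /= []; rewrite !lt_min => /and3P[st2 st1 sty].
  move=> /and3P[zt2 z1 z2] s01.
  exists (z', PosTime s01); rewrite /=.
  have [Nz Vz] : (Phi @^-1` N `&` V) (z', PosTime s01).
    by apply: e2N; rewrite /= /timed_dist /= gt_max z2.
  split=> //; exists x.
  have ts : t / 2 < s by move: st2; rewrite ltr_norml; lra.
  split; first by rewrite (gdistC rhoP); lra.
  have : N (f (x, PosTime s01)).
    by apply: e1N; rewrite /= /timed_dist /= gt_max (gdistxx dP) e10.
  move: Nz; rewrite /N /= (fE (x, PosTime s01)).
  have := gdist_triangle dP (set_val (f c))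
    (set_val (Phi (z', PosTime s01))) (F (x, unit_time (PosTime s01))).
  by rewrite (gdistC dP _ (set_val (f c))); lra.
have invi : invariant_set (range i).
  by move=> g _ [x _ <-]; exists (gact g x).
pose U : set Z := sel_dom (d := rho) (X := range i) (P := P).
pose lam : Z -> R := sel_time (d := rho) (X := range i) (P := P).
have invU : invariant_set U by exact: sel_dom_act.
(* The graph of the retraction. It is a relation because [(z, lam z)] is a point of the open
   cylinder only where [lam z] is positive; its uniqueness [rel_inj] later gives equivariance of the
   chosen [r]. *)
pose rel z x := z = i x \/ ~ range i z /\ exists y : open_cylinder rhoP,
  [/\ y.1 = z, time_val y.2 = lam z, V y & x = set_val (Phi y)].
have relP z : U z -> exists x, rel z x.
  move=> Uz; have [[x _ <-]|nz] := pselect (range i z); first by exists x; left.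
  have [y [y1 y2 Vy _]] := sel_timeP rhoP cli Uz nz.
  by exists (set_val (Phi y)); right; split=> //; exists y.
have rel_inj z x y : rel z x -> rel z y -> x = y.
  move=> [->|[nz [p [p1 p2 Vp ->]]]] [|[nz' [q [q1 q2 Vq ->]]]].
  - exact: inji.
  - by case: nz'; exists x.
  - by move=> zy; case: nz; exists y.
  - congr (set_val (Phi _)).
    case: p q p1 p2 q1 q2 {Vp Vq} => [z1 s] [z2 t] /= -> st -> ts.
    by congr (_, _); apply: pos_time_inj; rewrite st ts.
have rel_act g z x : rel z x -> rel (gact g z) (gact g x).
  move=> [->|[nz [y [y1 y2 Vy ->]]]]; first by left.
  right; split.
    by move=> /(invi g^-1%g); rewrite gactK.
  exists (gact g y); split; first by rewrite -y1.
  - by rewrite /= y2 /lam sel_time_act.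
  - exact: invV.
  - by rewrite aPhi.
have [r rP] := choice (fun u : gsubspace invU => relP _ (set_valP u)).
exists U, invU; split.
  rewrite (interior_id _).1; last exact: (sel_dom_open rhoP).
  exact: (sel_dom_sub rhoP P_near).
exists r; split; last first.
  by move=> u x ux; apply: (rel_inj (set_val u)) (rP u) _; left.
split; last first.
  by move=> g u; apply: rel_inj (rP _) _; exact: rel_act (rP u).
have cvalU : continuous (set_val : gsubspace invU -> Z).
  exact: initial_continuous.
move=> u N Nru; rewrite nbhs_simpl /=.
suff [M Mu MN] : exists2 M, nbhs (set_val u) M &
    forall z x, M z -> U z -> rel z x -> N x.
  have := cvalU u _ Mu; rewrite nbhs_simpl /=; apply: filterS => u' Mu'.
  exact: MN Mu' (set_valP u') (rP u').
have lam_near := sel_time_near rhoP cli P_near.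
have [ux|[nz [y [y1 y2 Vy ry]]]] := rP u.
  set x := r u in ux Nru.
  have [e e0 eN] := (gdist_nbhs dP _ _).1 Nru.
  have e20 : 0 < e / 2 by lra.
  have zero01 : (0 : R) \in (`[0, 1]%classic : set R).
    by apply/mem_set; rewrite /= in_itv /= lexx ler01.
  pose o : unit_interval R := exist _ 0 zero01.
  have : nbhs (F (x, o)) [set x' | d x x' < e / 2].
    by rewrite F0 //; exact: gdist_ball.
  move=> /cF[[N1 T] /= [N1x To] N1T].
  have [T' /nbhs_ballP[e1 /= e10 e1T'] T'T] := set_type_nbhs To.
  have [M] := embedding_nbhs ei (filterI N1x Nru).
  rewrite -ux => /(gdist_nbhs rhoP)[e2 e20' e2M] MN.
  (* For [z] off the image, [P] gives [x''] with [i x''] within [lam z] of [z]. The bound [e2 / 2]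
     brings [x''] near [x], [e1] brings the time near 0, so [F] at [x''] is within [e / 2] of [x];
     the bound [e / 2] does the same for [Phi] and [F]. *)
  pose e3 := Num.min (e / 2) (Num.min e1 (e2 / 2)).
  have e30 : 0 < e3 by rewrite !lt_min e20 e10; lra.
  have lam0 : lam (set_val u) = 0.
    by apply: (sel_time_in rhoP P_near); exists x.
  exists ([set z | rho (set_val u) z < e2 / 2] `&` [set z | lam z < e3]).
    apply: filterI; first by apply: (gdist_ball rhoP); lra.
    apply: filterS (lam_near _ _ e30) => z /=; rewrite -/lam lam0 subr0.
    by rewrite ltr_norml => /andP[].
  move=> z x' [/= uz]; rewrite !lt_min => /and3P[l_e l_e1 l_e2] Uz.
  move=> [zx'|[nz [y [y1 y2 Vy ->]]]].
    by have [] := MN x' (e2M _ _) => //=; rewrite -zx'; lra.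
  have [y' [y'1 y'2 Vy' [x'' [zx'' yx'']]]] := sel_timeP rhoP cli Uz nz.
  have yy' : y' = y.
    case: y y' y1 y2 y'1 y'2 {Vy Vy' yx''} => [z1 s] [z2 t] /= -> st -> ts.
    by congr (_, _); apply: pos_time_inj; rewrite st ts.
  move: yx''; rewrite yy' => yx''.
  have [N1x'' _] : (N1 `&` N) x''.
    apply: MN; apply: e2M => /=.
    by have := gdist_triangle rhoP z (set_val u) (i x'');
      move: zx''; rewrite -/(lam z); lra.
  have Ty : T (unit_time y.2).
    apply: T'T; apply: e1T'; rewrite /ball /= sub0r normrN.
    rewrite -[X in `|X|]/(time_val y.2) y2 ger0_norm //.
    exact: (sel_time_ge0 rhoP).
  have /= := N1T (x'', unit_time y.2) (conj N1x'' Ty).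
  move=> xF; apply: eN => /=; move: yx''; rewrite -/(lam z).
  have := gdist_triangle dP (F (x'', unit_time y.2)) x (set_val (Phi y)).
  by rewrite (gdistC dP (F (x'', unit_time y.2))); lra.
(* Off the closed set [range i] the retraction is locally [Phi] at [(z, lam z)], so continuity of
   [Phi] and [lam] suffices. *)
have : nbhs (Phi y) (set_val @^-1` N) by apply: cval; rewrite -ry.
move=> /(cPhi y Vy)/(gdist_nbhs YP)[e e0 eN].
exists ([set z | rho (set_val u) z < e] `&`
  [set z | `|lam z - lam (set_val u)| < e] `&` ~` range i).
  apply: filterI; last by apply: open_nbhs_nbhs; split=> //;
    exact: closed_openC.
  by apply: filterI; [exact: (gdist_ball rhoP) | exact: lam_near].
move=> z x [[/= uz lz] nzi] Uz [zx|[_ [y' [y'1 y'2 Vy' ->]]]].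
  by case: nzi; exists x.
apply: eN; rewrite /= /timed_dist gt_max y1 y'1 uz /= y2 y'2 distrC.
exact: lz.
Qed.

End NeighborhoodRetraction.

Theorem proposition5p5 (R : realType) (G : topologicalGroupType)
    (compactG : compact [set: G]) (hausdorffG : hausdorff_space G)
    (X : gSpaceType G) (metrizableX : metrizable R X)
    (A : set X) (invA : invariant_set A) (denseA : ghomotopy_dense R A)
    (anrA : G_ANR R (gsubspace invA)) :
  G_ANR R X.
Proof.
split=> // Z i mZ iP; have [_ [F [FP F0 FA]]] := denseA.
(* A point of X supplies the default value of the extension; for empty X the empty neighborhood
   works. *)
have [[x0 _]|noX] := pselect (exists x : X, True).
  exact: (ganr_neighborhood_retract FP F0 FA x0).
have inv0 : @invariant_set G Z set0 by [].
exists set0, inv0; split; first by move=> z [x]; case: noX; exists x.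
have empty (u : gsubspace inv0) : False := set_valP u.
exists (fun u => False_rect X (empty u)).
by split; [split=> [u|g u]|move=> u]; exfalso; exact: (empty u).
Qed.
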